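(* Let $u$ and $v$ be adjacent vertices of a graph $G$. Then $\gamma(G) \leq \gamma(G_{u,v,1}) \leq \gamma(G)+1$, and the following is true: (i) $\gamma(G) = \gamma(G_{u,v,1})$ if and only if at least one of $u$ and $v$ is a $\gamma$-good vertex of $G$. (ii) $\gamma(G_{u,v,1}) = \gamma(G)+1$ if and only if both $u$ and $v$ are $\gamma$-bad vertices of $G$.
   Context: Graphs are finite and simple. $\gamma(H)$ denotes the domination number of a graph $H$; a $\gamma$-set of $H$ is a dominating set of $H$ of cardinality $\gamma(H)$. A vertex of $H$ is $\gamma$-good if it belongs to some $\gamma$-set of $H$, and $\gamma$-bad if it belongs to no $\gamma$-set of $H$. For distinct vertices $u,v$ of $G$, $G_{u,v,1}$ is the graph obtained from $G$ by adding one new vertex $x_1$ and the edges $ux_1$ and $x_1v$ (the edge $uv$ of $G$, if present, is kept). *)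

(* Defs.v *)
From mathcomp Require Import all_boot.

Set Implicit Arguments.
Unset Strict Implicit.
Unset Printing Implicit Defensive.

Record sgraph := SGraph {
  vertex :> finType;
  adj : rel vertex;
  adj_sym : symmetric adj;
  adj_irr : irreflexive adj
}.

Section Domination.
Variable G : sgraph.

Definition dominating (D : {set G}) : bool :=
  [forall x : G, (x \in D) || [exists y in D, adj y x]].

(* The whole vertex set is dominating (see dominatingT), so the minimum below
   ranges over a nonempty family. *)
Definition gamma : nat :=
  #|[arg min_(D < [set: G] | dominating D) #|D|]|.

Definition gamma_set (D : {set G}) : bool :=
  dominating D && (#|D| == gamma).

Definition gamma_good (x : G) : bool := [exists D, gamma_set D && (x \in D)].

Definition gamma_bad (x : G) : bool := [forall D, gamma_set D ==> (x \notin D)].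

Lemma dominatingT : dominating [set: G].
Proof. by apply/forallP => x; rewrite in_setT. Qed.

Lemma gamma_min (D : {set G}) : dominating D -> gamma <= #|D|.
Proof.
rewrite /gamma; case: arg_minnP => [|D0 _ minD0 domD]; first exact: dominatingT.
exact: minD0.
Qed.

Lemma gamma_attained : exists2 D : {set G}, dominating D & #|D| = gamma.
Proof.
rewrite /gamma; case: arg_minnP => [|D domD _]; first exact: dominatingT.
by exists D.
Qed.

End Domination.

Section AddPath1.
Variables (G : sgraph) (u v : G).

(* G_{u,v,1} has vertex set option G, where Some x is the old vertex x and None is the new
   vertex x_1. *)
Definition add_path1_adj : rel (option G) := fun a b =>
  match a, b with
  | Some x, Some y => adj x y
  | None, Some y => (y == u) || (y == v)
  | Some x, None => (x == u) || (x == v)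
  | None, None => false
  end.

Lemma add_path1_sym : symmetric add_path1_adj.
Proof. by move=> [x|] [y|] //=; apply: adj_sym. Qed.

Lemma add_path1_irr : irreflexive add_path1_adj.
Proof. by move=> [x|] //=; apply: adj_irr. Qed.

Definition add_path1 : sgraph := SGraph add_path1_sym add_path1_irr.

End AddPath1.

(* Main.v *)
Require Import Defs.
From mathcomp Require Import all_boot.

(** The sets [Some @: D], for [D] a dominating set of [G] meeting [{u, v}],
    dominate the extended graph. Conversely a dominating set of the extended
    graph yields, at no extra cost, a dominating set of [G] meeting [{u, v}]:
    if it contains the new vertex, replace that vertex by [u], which dominates
    both [u] and [v] since they are adjacent; otherwise it already meets
    [{u, v}], because the new vertex is dominated. So the domination number of
    the extended graph is the least size of a dominating set of [G] meeting
    [{u, v}]. *)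

Lemma dominatingP (G : sgraph) (D : {set G}) :
  reflect (forall x, x \in D \/ exists2 y, y \in D & adj y x) (dominating D).
Proof.
apply: (iffP forallP) => domD x.
  by have /orP[|/exists_inP] := domD x; [left | right].
by apply/orP; case: (domD x) => [|/exists_inP]; [left | right].
Qed.

Lemma gamma_badE (G : sgraph) (x : G) : gamma_bad x = ~~ gamma_good x.
Proof.
by rewrite negb_exists; apply: eq_forallb => D; rewrite negb_and implybE.
Qed.

Section AddPath1Domination.
Set Implicit Arguments.
Unset Strict Implicit.
Variables (G : sgraph) (u v : G).
Notation H := (add_path1 u v).

Lemma dominating_imset_Some (D : {set G}) :
  dominating D -> (u \in D) || (v \in D) ->
  dominating (Some @: D : {set H}).
Proof.
move=> /dominatingP domD uvD; apply/dominatingP => -[x|].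
  case: (domD x) => [Dx|[y Dy yx]]; first by left; apply: imset_f.
  by right; exists (Some y); rewrite ?imset_f.
by right; case/orP: uvD => Dw; [exists (Some u) | exists (Some v)];
  rewrite ?imset_f //= eqxx ?orbT.
Qed.

(** Paying one extra element for the new vertex itself removes the need to meet [{u, v}], whence the
    upper bound [gamma G + 1]. *)
Lemma dominating_None_imset_Some (D : {set G}) :
  dominating D -> dominating (None |: Some @: D : {set H}).
Proof.
move=> /dominatingP domD; apply/dominatingP => -[x|]; last by left; rewrite !inE.
case: (domD x) => [Dx|[y Dy yx]]; first by left; rewrite inE imset_f ?orbT.
by right; exists (Some y); rewrite // inE imset_f ?orbT.
Qed.

Lemma dominating_meet_add_path1 (D : {set H}) :
  adj u v -> dominating D ->
  exists D' : {set G},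
    [/\ dominating D', #|D'| <= #|D| & (u \in D') || (v \in D')].
Proof.
move=> uv /dominatingP domD; pose P : {set G} := [set x | Some x \in D].
have imP : Some @: P = D :\ (None : H).
  apply/setP => -[x|]; rewrite !inE.
    by rewrite (mem_imset _ _ Some_inj) inE.
  by apply/imsetP => -[].
have cardP : #|D| = (None \in D) + #|P|.
  by rewrite (cardsD1 (None : H)) -imP (card_imset _ Some_inj).
case: (boolP ((None : H) \in D)) cardP => [_|ND] /= cardP.
  exists (u |: P); split; last by rewrite setU11.
    apply/dominatingP => x; have [->|xu] := eqVneq x u.
      by left; rewrite setU11.
    case: (domD (Some x)) => [Dx|[[y|] Dy /= yx]].
    - by left; rewrite !inE Dx orbT.
    - by right; exists y; rewrite // !inE Dy orbT.
    (* Here [x] is dominated by the new vertex, so it is [u] or [v]; being distinct from [u], it is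
       [v], and the edge [uv] applies. *)
    - by right; exists u; rewrite ?setU11 //; move: yx; rewrite (negPf xu) => /eqP->.
  (* Only an inequality holds: [u] may already lie in [P]. *)
  by rewrite cardP cardsU1 leq_add2r leq_b1.
exists P; split; last 1 first.
- case: (domD None) => [|[[y|] Dy //= /orP[] /eqP <-]]; first by rewrite (negPf ND).
    by rewrite inE Dy.
  by rewrite !inE Dy orbT.
- apply/dominatingP => x; case: (domD (Some x)) => [Dx|[[y|] Dy /= yx]].
  + by left; rewrite inE.
  + by right; exists y; rewrite // inE.
  + by rewrite Dy in ND.
- by rewrite cardP.
Qed.

Lemma gamma_le_add_path1 : adj u v -> gamma G <= gamma H.
Proof.
move=> uv; have [D domD <-] := gamma_attained H.
have [D' [domD' leD _]] := dominating_meet_add_path1 uv domD.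
exact: leq_trans (gamma_min domD') leD.
Qed.

Lemma gamma_add_path1_le : gamma H <= gamma G + 1.
Proof.
have [D domD <-] := gamma_attained G.
apply: leq_trans (gamma_min (dominating_None_imset_Some domD)) _.
by rewrite cardsU1 (card_imset _ Some_inj) addnC leq_add2l leq_b1.
Qed.

(** A minimum dominating set of [G] through [u] or [v] lifts at the same size. Conversely, if the
    two numbers agree, a minimum dominating set of [H] pulls back to one of [G] that meets [{u, v}]
    and is small enough to be a [gamma_set]. *)
Lemma gamma_add_path1_eqP :
  adj u v -> reflect (gamma G = gamma H) (gamma_good u || gamma_good v).
Proof.
move=> uv; apply: (iffP idP) => [uv_good|eqG].
  have [D /andP[domD /eqP cardD] uvD] :
      exists2 D, gamma_set D & (u \in D) || (v \in D).
    by case/orP: uv_good => /existsP[D /andP[gD Dw]]; exists D; rewrite ?Dw ?orbT.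
  apply/eqP; rewrite eqn_leq gamma_le_add_path1 //= -cardD -(card_imset _ Some_inj).
  exact: gamma_min (dominating_imset_Some domD uvD).
have [D domD cardD] := gamma_attained H.
have [D' [domD' leD uvD']] := dominating_meet_add_path1 uv domD.
have gD' : gamma_set D'.
  by rewrite /gamma_set domD' eqn_leq gamma_min // eqG -cardD leD.
by case/orP: uvD' => Dw; apply/orP; [left | right]; apply/existsP; exists D';
  rewrite gD'.
Qed.

End AddPath1Domination.

Theorem theorem2 (G : sgraph) (u v : G) (huv : adj u v) :
  [/\ gamma G <= gamma (add_path1 u v) <= gamma G + 1,
      gamma G = gamma (add_path1 u v) <-> gamma_good u \/ gamma_good v
    & gamma (add_path1 u v) = gamma G + 1 <-> gamma_bad u /\ gamma_bad v].
Proof.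
have leG := gamma_le_add_path1 huv; have leH := gamma_add_path1_le u v.
have eqP1 := gamma_add_path1_eqP huv.
split; first by rewrite leG.
  by split=> [/eqP1/orP | /orP/eqP1].
(* The bounds leave only two values for the domination number of the extended graph, so this
   equivalence is the negation of the previous one. *)
rewrite !gamma_badE; split=> [eqH | /andP].
  apply/andP; rewrite -negb_or; apply/eqP1 => /eqP.
  by rewrite eqH addn1 eqn_leq ltnn andbF.
rewrite -negb_or => /eqP1 neqG; apply/eqP.
rewrite eqn_leq leH addn1 ltn_neqAle leG andbT.
exact/eqP.
Qed.
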